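(* Let $D\ge 3$ be an integer, $\omega>0$ and $1+\frac{4}{D}\le p<1+\frac{4}{D-2}$. Then $d_{\mathfrak{N}}\le d_{\mathfrak{M}}$.
   Context: All functions are complex valued on $\mathbb{R}^D$, and $*$ is convolution: $(|x|^{-2}*|u|^2)(x)=\int_{\mathbb{R}^D}\frac{|u(y)|^2}{|x-y|^2}dy$. For $u\in H^1(\mathbb{R}^D)$ set $$\mathcal{K}[u]=\int_{\mathbb{R}^{D}}|\nabla u|^{2}dx+\omega\int_{\mathbb{R}^{D}}|u|^{2}dx,$$ $$\mathcal{L}[u]=\frac12\mathcal{K}[u]-\frac{1}{p+1}\int_{\mathbb{R}^{D}}|u|^{p+1}dx-\frac14\int_{\mathbb{R}^{D}}(|x|^{-2}*|u|^{2})|u|^{2}dx,$$ $$\mathcal{N}[u]=\mathcal{K}[u]-\int_{\mathbb{R}^{D}}|u|^{p+1}dx-\int_{\mathbb{R}^{D}}(|x|^{-2}*|u|^{2})|u|^{2}dx,$$ $$\mathcal{V}[u]=\int_{\mathbb{R}^{D}}|\nabla u|^{2}dx-\frac{D(p-1)}{2(p+1)}\int_{\mathbb{R}^{D}}|u|^{p+1}dx-\frac12\int_{\mathbb{R}^{D}}(|x|^{-2}*|u|^{2})|u|^{2}dx.$$ Let $\mathfrak{N}=\{u\in H^{1}(\mathbb{R}^{D})\setminus\{0\}:\ \mathcal{N}[u]=0\}$, $d_{\mathfrak{N}}=\inf_{u\in\mathfrak{N}}\mathcal{L}[u]$, $\mathfrak{M}=\{u\in H^{1}(\mathbb{R}^{D}):\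 \mathcal{N}[u]<0,\ \mathcal{V}[u]=0\}$ and $d_{\mathfrak{M}}=\inf_{u\in\mathfrak{M}}\mathcal{L}[u]$. *)

(* Defs.v *)
From HB Require Import structures.
From mathcomp Require Import all_boot all_order all_algebra.
From mathcomp Require Import all_classical all_reals all_analysis.
From mathcomp Require Import complex.

Set Implicit Arguments.
Unset Strict Implicit.
Unset Printing Implicit Defensive.
Import Order.TTheory GRing.Theory Num.Theory.
Import numFieldNormedType.Exports.

Local Open Scope classical_set_scope.
Local Open Scope complex_scope.
Local Open Scope ring_scope.

(** * Lebesgue measure on R^n, with R^n := 'rV[R]_n *)

(* The product sigma-algebra, i.e. the Borel sigma-algebra of R^n, defined as
   the library does for n.-tuple. *)
Section measurable_rV.
Context (R : realType) (n : nat).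

Let coord (i : 'I_n) (x : 'rV[R]_n) : measurableTypeR R := x 0 i.

Let rV_set0 : g_sigma_preimage coord set0.
Proof. exact: sigma_algebra0. Qed.

Let rV_setC A : g_sigma_preimage coord A -> g_sigma_preimage coord (~` A).
Proof. exact: sigma_algebraC. Qed.

Let rV_bigcup (F : (set 'rV[R]_n)^nat) :
  (forall i, g_sigma_preimage coord (F i)) ->
  g_sigma_preimage coord (\bigcup_i (F i)).
Proof. exact: sigma_algebra_bigcup. Qed.

HB.instance Definition _ := @isMeasurable.Build default_measure_display
  'rV[R]_n (g_sigma_preimage coord) rV_set0 rV_setC rV_bigcup.

Lemma measurable_rV_coord (i : 'I_n) :
  measurable_fun [set: 'rV[R]_n] (fun x : 'rV[R]_n => x 0 i : measurableTypeR R).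
Proof.
move=> _ Y mY; rewrite setTI; apply: sub_sigma_algebra => /=.
rewrite -bigcup_seq/=; exists i => /=; first by rewrite mem_index_enum.
by exists Y => //; rewrite setTI.
Qed.

Lemma measurable_fun_rV d (T : measurableType d) (f : T -> 'rV[R]_n) :
  (forall i, measurable_fun [set: T] (fun t => f t 0 i : measurableTypeR R)) ->
  measurable_fun [set: T] f.
Proof.
move=> mf _ A mA; rewrite setTI.
pose G := [set B : set 'rV[R]_n | measurable (f @^-1` B)].
suff : g_sigma_preimage coord `<=` G by apply.
apply: smallest_sub.
  split => [|B GB|F GF].
  - by rewrite /G/= preimage_set0.
  - by rewrite /G/= setTD preimage_setC; exact: measurableC.
  - by rewrite /G/= preimage_bigcup; apply: bigcupT_measurable => k; exact: GF.
rewrite -bigcup_seq => B [i _ [C mC <-]]; rewrite /G/= setTI.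
have /= := mf i measurableT C mC; by rewrite setTI.
Qed.

End measurable_rV.

Section lebesgue_rV.
Context (R : realType).

Definition consrV n (x : measurableTypeR R * 'rV[R]_n) : 'rV[R]_n.+1 :=
  \row_i oapp (x.2 0) x.1 (unlift ord0 i).

Lemma measurable_consrV n : measurable_fun setT (@consrV n).
Proof.
apply: measurable_fun_rV => i; under eq_fun do rewrite mxE.
case: unliftP => [j _|_] /=; last exact: measurable_fst.
apply: (measurableT_comp (@measurable_rV_coord R n j)).
exact: measurable_snd.
Qed.

HB.instance Definition _ n :=
  @isMeasurableFun.Build _ _ _ _ (@consrV n) (@measurable_consrV n).

Section succ.
Context n (mu : {sigma_finite_measure set 'rV[R]_n -> \bar R}).

Definition lebesgue_rVS : set 'rV[R]_n.+1 -> \bar R :=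
  pushforward (@lebesgue_measure R \x mu)%E (@consrV n).

Let lebesgue_rVS0 : lebesgue_rVS set0 = 0%E.
Proof. exact: measure0. Qed.

Let lebesgue_rVS_ge0 A : (0 <= lebesgue_rVS A)%E.
Proof. exact: measure_ge0. Qed.

Let lebesgue_rVS_sigma_additive : semi_sigma_additive lebesgue_rVS.
Proof. exact: measure_semi_sigma_additive. Qed.

HB.instance Definition _ := isMeasure.Build _ _ _ lebesgue_rVS
  lebesgue_rVS0 lebesgue_rVS_ge0 lebesgue_rVS_sigma_additive.

Let lebesgue_rVS_sigma_finite : sigma_finite setT lebesgue_rVS.
Proof.
have /sigma_finiteP[F [FT ndF mF]] := sigma_finiteT (@lebesgue_measure R).
have /sigma_finiteP[G [GT ndG mG]] := sigma_finiteT mu.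
pose hd (y : 'rV[R]_n.+1) : measurableTypeR R := y 0 ord0.
pose tl (y : 'rV[R]_n.+1) : 'rV[R]_n := \row_i y 0 (lift ord0 i).
have mhd : measurable_fun setT hd by exact: measurable_rV_coord.
have mtl : measurable_fun setT tl.
  apply: measurable_fun_rV => i; under eq_fun do rewrite mxE.
  exact: measurable_rV_coord.
exists (fun k => hd @^-1` F k `&` tl @^-1` G k).
  apply/esym; rewrite -subTset => y _.
  have : setT (hd y) by []. rewrite FT => -[k _ Fk].
  have : setT (tl y) by []. rewrite GT => -[l _ Gl].
  exists (maxn k l) => //; split.
  - have : F k `<=` F (maxn k l) by exact/subsetPset/ndF/leq_maxl.
    exact.
  - have : G l `<=` G (maxn k l) by exact/subsetPset/ndG/leq_maxr.
    exact.
move=> k; have [mFk Fk] := mF k; have [mGk Gk] := mG k; split.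
  apply: measurableI; rewrite -[X in measurable X]setTI.
    exact: mhd.
  exact: mtl.
rewrite /lebesgue_rVS /pushforward.
rewrite [X in product_measure1 _ _ X](_ : _ = F k `*` G k).
  by rewrite product_measure1E// lte_mul_pinfty// ge0_fin_numE.
apply/seteqP; split => -[a b] /=; rewrite /hd /tl /consrV mxE unlift_none /=.
all: rewrite (_ : \row__ _ = b)//.
all: by apply/rowP => i; rewrite !mxE liftK.
Qed.

HB.instance Definition _ := Measure_isSigmaFinite.Build _ _ _ lebesgue_rVS
  lebesgue_rVS_sigma_finite.

End succ.

Fixpoint lebesgue_rV n : {sigma_finite_measure set 'rV[R]_n -> \bar R} :=
  match n with
  | 0%N => @dirac _ 'rV[R]_0 0 R
  | n'.+1 => lebesgue_rVS (lebesgue_rV n')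
  end.

End lebesgue_rV.

(** * Complex-valued functions and the Sobolev space H^1(R^n) *)

Section sobolev.
Context (R : realType) (n : nat).
Implicit Types (f g : 'rV[R]_n -> R[i]) (phi : 'rV[R]_n -> R).

Definition cmeasurable f :=
  measurable_fun setT (fun x => complex.Re (f x)) /\
  measurable_fun setT (fun x => complex.Im (f x)).

Definition square_integrable f :=
  cmeasurable f /\
  (\int[lebesgue_rV R n]_x ((Normc.normc (f x)) ^+ 2)%:E < +oo)%E.

Definition cintegral f : R[i] :=
  (\int[lebesgue_rV R n]_x complex.Re (f x)) +i* (\int[lebesgue_rV R n]_x complex.Im (f x)).

(* iterated_partial [:: i1; ...; ik] phi = d_i1 (... (d_ik phi)) *)
Definition iterated_partial (s : seq 'I_n) phi : 'rV[R]_n -> R :=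
  foldr (fun i psi x => 'D_(delta_mx 0 i) psi x) phi s.

Definition smooth phi := forall s : seq 'I_n,
  continuous (iterated_partial s phi) /\
  forall i x, derivable (iterated_partial s phi) x (delta_mx 0 i).

Definition test_function phi :=
  smooth phi /\ compact (closure [set x | phi x != 0]).

(* Real test functions suffice: the identity is linear in phi, so it extends
   to complex test functions. *)
Definition weak_partial (i : 'I_n) f g := forall phi, test_function phi ->
  cintegral (fun x => f x * ('D_(delta_mx 0 i) phi x)%:C) =
  - cintegral (fun x => g x * (phi x)%:C).

(* An element of H^1 is given by representatives of u and of its weak gradient.
   The weak gradient is determined by u up to a null set, so no quantity below
   depends on the representative stored in H1_grad. *)
Record H1 := MkH1 {
  H1_fun :> 'rV[R]_n -> R[i] ;
  H1_grad : 'I_n -> 'rV[R]_n -> R[i] ;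
  H1_square_integrable : square_integrable H1_fun ;
  H1_grad_square_integrable : forall i, square_integrable (H1_grad i) ;
  H1_weak_partial : forall i, weak_partial i H1_fun (H1_grad i) }.

(* u = 0 in H^1, whose elements are identified when equal almost everywhere *)
Definition H1_eq0 (u : H1) := {ae lebesgue_rV R n, forall x, u x = 0}.

End sobolev.

(** * The functionals *)

Section functionals.
Context (R : realType) (D : nat).
Context (omega p : R).
Implicit Types (u : H1 R D) (x y : 'rV[R]_D).

Local Notation mu := (lebesgue_rV R D).

(* The norm `|x| of 'rV[R]_D is the sup norm, hence this definition. *)
Definition enorm x : R := Num.sqrt (\sum_i x 0 i ^+ 2).

Definition grad_norm_sq u x : R :=
  \sum_i Normc.normc (H1_grad u i x) ^+ 2.

Definition dirichlet u : R := \int[mu]_x grad_norm_sq u x.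

Definition mass u : R := \int[mu]_x (Normc.normc (u x) ^+ 2).

Definition power_term u : R := \int[mu]_x (Normc.normc (u x) `^ (p + 1)).

(* |x|^{-2} * |u|^2 at x, a priori in [0, +oo]. The integrand is 0 at y = x (1 / 0 = 0),
   a null set. *)
Definition hartree_potential u x : \bar R :=
  (\int[mu]_y (Normc.normc (u y) ^+ 2 / enorm (x - y) ^+ 2)%:E)%E.

(* Finite for D >= 3 by the Hardy-Littlewood-Sobolev inequality, so that fine
   only changes its type. *)
Definition hartree u : R :=
  fine (\int[mu]_x (hartree_potential u x * (Normc.normc (u x) ^+ 2)%:E))%E.

Definition Kfun u : R := dirichlet u + omega * mass u.

Definition Lfun u : R :=
  2^-1 * Kfun u - (p + 1)^-1 * power_term u - 4^-1 * hartree u.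

Definition Nfun u : R := Kfun u - power_term u - hartree u.

Definition Vfun u : R :=
  dirichlet u - D%:R * (p - 1) / (2 * (p + 1)) * power_term u
  - 2^-1 * hartree u.

Definition frakN : set (H1 R D) := [set u | ~ H1_eq0 u /\ Nfun u = 0].

Definition frakM : set (H1 R D) := [set u | Nfun u < 0 /\ Vfun u = 0].

(* Infima in the extended reals, with ereal_inf set0 = +oo *)
Definition dN : \bar R := ereal_inf [set (Lfun u)%:E | u in frakN].

Definition dM : \bar R := ereal_inf [set (Lfun u)%:E | u in frakM].

End functionals.

(* Main.v *)
Require Import Defs.
From HB Require Import structures.
From mathcomp Require Import all_boot all_order all_algebra.
From mathcomp Require Import all_classical all_reals all_analysis.
From mathcomp Require Import measurable_realfun complex ring lra.

(** The comparison rests on the L^2-invariant dilations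
      u_s (x) = e^(D s / 2) u (e^s x),  s real,
    which keep the mass fixed, multiply both the Dirichlet and the Hartree term
    by e^(2 s), and multiply the power term by e^(q s) with q = D (p - 1) / 2
    (the lemmas named [_L2dilation]).  The lower bound on p says q >= 2.

    Take u with N[u] < 0 and V[u] = 0, and write A, M, P, H for its Dirichlet
    integral, mass, power term and Hartree term.

    - N[u_s] = e^(2 s) (A - H) + omega M - e^(q s) P is negative at s = 0 and
      tends to omega M > 0 as s tends to -oo, so N[u_s] = 0 for some s <= 0
      ([exists_dilation_zero]).  Here M > 0 because a null u would have
      N[u] = A >= 0 ([mass_gt0]); since the mass is invariant, u_s is not null
      either, and u_s is a competitor for the infimum over N = 0.
    - V[u] = 0 says that s = 0 is a critical point of s |-> L[u_s], and it is
      the maximum: eliminating A with V[u] = 0 gives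
        L[u] - L[u_s] = P / (p + 1) * ((e^(q s) - 1) - q / 2 (e^(2 s) - 1)),
      which is nonnegative by convexity ([ler_expR_powers]).

    Hence the infimum over N = 0 is at most L[u_s] <= L[u].

    The remaining work is to show that u_s is again an element of H^1 with the
    announced integrals.  Everything reduces to one change of variables,
    [integral_dilation], stated for arbitrary extended real functions: the
    integral of a nonnegative function is a supremum over the simple functions
    below it, and a bijective dilation permutes these.  In that generality it
    applies directly to the iterated Hartree integral and to products with test
    functions, and the scaling laws hold for infinite integrals too. *)

Set Implicit Arguments.
Unset Strict Implicit.
Unset Printing Implicit Defensive.
Import Order.TTheory GRing.Theory Num.Theory.
Import numFieldNormedType.Exports.

Local Open Scope classical_set_scope.
Local Open Scope ring_scope.

(** * Change of variables for arbitrary functions *)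

Section integral_scaling.
Local Open Scope ereal_scope.
Context d (T : measurableType d) (R : realType) (mu : {measure set T -> \bar R}).
Import HBSimple HBNNSimple.

Section le.
Variables (S : T -> T) (c a : R).
Hypotheses (mS : measurable_fun setT S) (c0 : (0 < c)%R) (a0 : (0 < a)%R).
Hypothesis muS : forall A, measurable A -> mu (S @^-1` A) = c%:E * mu A.

Section comp.
Variable h : {nnsfun T >-> R}.
Let hS : T -> R := h \o S.
Let hS_measurable : measurable_fun setT hS.
Proof. exact: measurableT_comp. Qed.
#[local] HB.instance Definition _ := isMeasurableFun.Build _ _ _ _ hS hS_measurable.
Let hS_fin : finite_set (range hS).
Proof.
by apply: sub_finite_set (@fimfunP _ _ h) => _ [x _ <-]; exists (S x).
Qed.
#[local] HB.instance Definition _ := FiniteImage.Build _ _ hS hS_fin.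
Let hS_ge0 x : (0 <= hS x)%R.
Proof. exact: fun_ge0. Qed.
#[local] HB.instance Definition _ := isNonNegFun.Build _ _ hS hS_ge0.

Definition nnsfun_comp : {nnsfun T >-> R} := hS.

Lemma sintegral_nnsfun_comp : sintegral mu nnsfun_comp = c%:E * sintegral mu h.
Proof.
rewrite !sintegralET ge0_mule_fsumr; last exact: nnsfun_mulemu_ge0.
apply: eq_fsbigr => x _; rewrite [RHS]muleCA; congr (_ * _).
by rewrite -muS//= comp_preimage.
Qed.

End comp.

(** Composing with [S] the simple functions below [f] produces only some of the
    simple functions below [f \o S], hence an inequality; the converse follows
    by applying it to the inverse of [S]. *)
Lemma ge0_integral_scaling_le (f : T -> \bar R) : (forall x, 0 <= f x) ->
  (a * c)%:E * \int[mu]_x f x <= \int[mu]_x (a%:E * f (S x)).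
Proof.
move=> f0; have ac0 : (0 < a * c)%R by rewrite mulr_gt0.
rewrite !ge0_integralTE//; last by move=> x; rewrite mule_ge0// lee_fin ltW.
rewrite -lee_pdivlMl//; apply: ge_ereal_sup => _ [h /= hf <-].
rewrite lee_pdivlMl// EFinM -muleA -sintegral_nnsfun_comp -sintegralrM.
apply: ereal_sup_ubound; exists (scale_nnsfun (nnsfun_comp h) (ltW a0)) => //=.
by move=> x; rewrite EFinM lee_pmul2l// ?lte_fin//; exact: hf.
Qed.

End le.

Variables (S S' : T -> T) (c a : R).
Hypotheses (mS : measurable_fun setT S) (mS' : measurable_fun setT S').
Hypotheses (SK : cancel S S') (S'K : cancel S' S).
Hypotheses (c0 : (0 < c)%R) (a0 : (0 < a)%R).
Hypothesis muS : forall A, measurable A -> mu (S @^-1` A) = c%:E * mu A.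

Let ge0_integral_scaling (f : T -> \bar R) :
  (forall x, 0 <= f x) -> \int[mu]_x (a%:E * f (S x)) = (a * c)%:E * \int[mu]_x f x.
Proof.
move=> f0; apply/eqP; rewrite eq_le; apply/andP; split; last first.
  exact: ge0_integral_scaling_le.
have muS' A : measurable A -> mu (S' @^-1` A) = (c^-1)%:E * mu A.
  move=> mA; rewrite -[X in _ = _ * mu X](_ : S @^-1` (S' @^-1` A) = A).
    rewrite muS; last by rewrite -[X in measurable X]setTI; exact: mS'.
    by rewrite muleA -EFinM mulVf ?mul1e// gt_eqF.
  by rewrite -comp_preimage; apply/seteqP; split => x /=; rewrite SK.
have /= := @ge0_integral_scaling_le S' c^-1 a^-1 mS' _ _ muS'
  (fun x => a%:E * f (S x)) _.
rewrite !invr_gt0 => /(_ c0 a0); rewrite -invfM.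
rewrite -lee_pdivlMl ?invr_gt0 ?mulr_gt0// invrK => le.
apply: (le_trans (le _)).
  by move=> x; rewrite mule_ge0// lee_fin ltW.
rewrite le_eqVlt; apply/predU1P; left; congr (_ * _); apply: eq_integral => x _.
by rewrite S'K muleA -EFinM mulVf ?mul1e// gt_eqF.
Qed.

(** The integral is not homogeneous a priori on arbitrary functions, which is why
    the constant [a] is part of the statement; the proof absorbs it into the
    simple functions. *)
Lemma integral_scaling (f : T -> \bar R) :
  \int[mu]_x (a%:E * f (S x)) = (a * c)%:E * \int[mu]_x f x.
Proof.
rewrite integralE [in RHS]integralE.
have -> : (fun x => a%:E * f (S x))^\+ = (fun x => a%:E * f^\+ (S x)).
  by apply/funext => x; rewrite !funeposE maxe_pMr ?lee_fin ?ltW// mule0.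
have -> : (fun x => a%:E * f (S x))^\- = (fun x => a%:E * f^\- (S x)).
  by apply/funext => x; rewrite !funenegE maxe_pMr ?lee_fin ?ltW// muleN mule0.
rewrite !ge0_integral_scaling//.
have ac0 : (0 < a * c)%R by rewrite mulr_gt0.
have : 0 <= \int[mu]_x f^\+ x by exact: integral_ge0.
have : 0 <= \int[mu]_x f^\- x by exact: integral_ge0.
case: (\int[mu]_x f^\- x) => [r| |] // _; case: (\int[mu]_x f^\+ x) => [s| |] // _.
(* The case +oo - +oo, equal to -oo by convention, falls outside distributivity. *)
all: try by rewrite [RHS]muleBr// fin_num_adde_defl.
by rewrite gt0_muley ?lte_fin// -[LHS]/-oo -[X in _ * X]/-oo gt0_muleNy ?lte_fin.
Qed.

End integral_scaling.

Section integral_ae_eq0.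
Import HBSimple HBNNSimple.

(** Every simple function below [f] vanishes almost everywhere, and the integral of
    an arbitrary nonnegative [f] is the supremum of their integrals. *)
Lemma ge0_integral_ae_eq0 d (T : measurableType d) (R : realType)
  (mu : {measure set T -> \bar R}) (f : T -> \bar R) :
  (forall x, 0 <= f x)%E -> {ae mu, forall x, f x = 0%E} ->
  (\int[mu]_x f x = 0)%E.
Proof.
move=> f0 fae; apply/eqP; rewrite eq_le integral_ge0 ?andbT//.
rewrite ge0_integralTE//; apply: ge_ereal_sup => _ [h /= hf <-].
have h0 x : (0 <= (h x)%:E)%E by rewrite lee_fin; exact: fun_ge0.
have mh : measurable_fun setT (fun x => (h x)%:E) by exact/measurable_EFinP.
have /(ae_eq_integral_abs mu measurableT mh) : ae_eq mu setT (fun x => (h x)%:E) (cst 0%E).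
  case: fae => N [mN N0 subN]; exists N; split=> // x /= hx; apply: subN => /= fx.
  by apply: hx => _; apply/eqP; rewrite eq_le h0 andbT -fx hf.
rewrite (eq_integral (fun x => (h x)%:E)); last by move=> x _; exact: gee0_abs.
by rewrite integral_nnsfun// patch_setT => ->.
Qed.

End integral_ae_eq0.

(** * Dilations and Lebesgue measure *)

Section dilation.
Variable R : realType.

(** [fine] sends both infinities to 0, so it commutes with positive multiples at
    infinite values as well. *)
Lemma fine_pmull (c : R) (x : \bar R) : 0 < c -> fine (c%:E * x)%E = c * fine x.
Proof.
case: x => [y| |] c0 //=; rewrite mulr0.
  by rewrite gt0_muley ?lte_fin.
by rewrite gt0_muleNy ?lte_fin.
Qed.

Lemma lebesgue_measure_dilation (r : R) (A : set (measurableTypeR R)) :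
  0 < r -> measurable A ->
  lebesgue_measure (( *%R r : measurableTypeR R -> measurableTypeR R) @^-1` A) =
  ((r^-1)%:E * lebesgue_measure A)%E.
Proof.
move=> r0 mA.
have mr : measurable_fun setT ( *%R r : measurableTypeR R -> measurableTypeR R).
  exact: mulrl_measurable.
have [m mE] : exists m : {measure set (measurableTypeR R) -> \bar R}, forall B,
    m B = (r%:E * lebesgue_measure (( *%R r : measurableTypeR R -> _) @^-1` B))%E.
  by unshelve eexists (mscale (NngNum (ltW r0)) (pushforward (@lebesgue_measure R)
    ( *%R r : measurableTypeR R -> measurableTypeR R))).
rewrite [in RHS](@lebesgue_measure_unique R m)//.
  by rewrite mE muleA -EFinM mulVf ?mul1e// gt_eqF.
move=> _ [[a b] _ <-]; rewrite mE.
rewrite (_ : _ @^-1` _ = `]r^-1 * a, r^-1 * b]%classic); last first.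
  apply/seteqP; split => x /=; rewrite !in_itv/=.
    by rewrite ltr_pdivrMl// ler_pdivlMl.
  by rewrite ltr_pdivrMl// ler_pdivlMl.
rewrite !lebesgue_measure_itv/= !lte_fin ltr_pM2l ?invr_gt0//.
case: ifPn => _; last by rewrite mule0.
by rewrite -!EFinB -EFinM -mulrBr mulVKf// gt_eqF.
Qed.

Lemma measurable_dilation n (r : R) :
  measurable_fun setT ( *:%R r : 'rV[R]_n -> 'rV[R]_n).
Proof.
apply: measurable_fun_rV => i; under eq_fun do rewrite mxE.
apply: (measurableT_comp (mulrl_measurable r)).
exact: measurable_rV_coord.
Qed.

(** By induction on the dimension: the [r * x]-section of a set, dilated by [r],
    is the [x]-section of the dilated set, so each coordinate contributes one
    factor [r^-1] through the one-dimensional change of variables. *)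
Lemma lebesgue_rV_dilation n (r : R) (A : set 'rV[R]_n) :
  0 < r -> measurable A ->
  lebesgue_rV R n ( *:%R r @^-1` A) = ((r ^- n)%:E * lebesgue_rV R n A)%E.
Proof.
move=> r0; elim: n A => [|n IHn] A mA.
  rewrite expr0 invr1 mul1e; congr (lebesgue_rV _ _ _).
  by apply/seteqP; split => x /=; rewrite (_ : r *: x = x)//; apply/rowP; case.
rewrite /= /lebesgue_rVS /pushforward /product_measure1.
set B := @consrV R n @^-1` A.
have mB : measurable B by rewrite -[X in measurable X]setTI; exact: measurable_consrV.
rewrite (eq_integral (fun x : measurableTypeR R =>
    ((r ^- n)%:E * (lebesgue_rV R n \o xsection B) (r * x)%R))%E); last first.
  move=> x _ /=; rewrite -IHn; last exact: measurable_xsection.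
  congr (lebesgue_rV _ _ _); apply/seteqP; split => y;
    rewrite /xsection /= !inE /B /=;
    rewrite (_ : r *: consrV (x, y) = consrV (r * x, r *: y))//;
    apply/rowP => i; rewrite !mxE; case: unliftP => [j _|_] //=; rewrite mxE//.
transitivity ((r ^- n * r^-1)%:E *
    \int[lebesgue_measure]_x (lebesgue_rV R n \o xsection B) x)%E; last first.
  by rewrite exprSr invfM mulrC.
apply: (@integral_scaling _ (measurableTypeR R) _ _ ( *%R r) ( *%R r^-1)).
- exact: mulrl_measurable.
- exact: mulrl_measurable.
- by apply: mulKf; rewrite gt_eqF.
- by apply: mulVKf; rewrite gt_eqF.
- by rewrite invr_gt0.
- by rewrite invr_gt0 exprn_gt0.
- by move=> C mC; exact: lebesgue_measure_dilation.
Qed.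

Lemma integral_dilation n (r a : R) (f : 'rV[R]_n -> \bar R) : 0 < r -> 0 < a ->
  (\int[lebesgue_rV R n]_x (a%:E * f (r *: x)%R) =
   (a * r ^- n)%:E * \int[lebesgue_rV R n]_x f x)%E.
Proof.
move=> r0 a0.
apply: (@integral_scaling _ 'rV[R]_n R (lebesgue_rV R n)
  ( *:%R r) ( *:%R r^-1) (r ^- n) a _ _ _ _ _ _ _ f) => //.
- exact: measurable_dilation.
- exact: measurable_dilation.
- by apply: scalerK; rewrite gt_eqF.
- by apply: scalerKV; rewrite gt_eqF.
- by rewrite invr_gt0 exprn_gt0.
- by move=> A mA; exact: lebesgue_rV_dilation.
Qed.

Lemma Rintegral_dilation n (r a : R) (f : 'rV[R]_n -> R) : 0 < r -> 0 < a ->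
  \int[lebesgue_rV R n]_x (a * f (r *: x)) =
   a * r ^- n * \int[lebesgue_rV R n]_x f x.
Proof.
move=> r0 a0; rewrite /Rintegral; under eq_integral do rewrite EFinM.
rewrite (integral_dilation (EFin \o f))//.
by rewrite fine_pmull// divr_gt0// exprn_gt0.
Qed.

End dilation.

(** * Dilations of test functions *)

Section derive_dilation.
Variables (R : realType) (n : nat).
Implicit Types (f phi : 'rV[R]_n -> R) (x v : 'rV[R]_n).

Lemma cvg_difference_quotient_dilation (r : R) f x v : r != 0 ->
  derivable f (r *: x) v ->
  h^-1 *: ((f \o *:%R r) (h *: v + x) - (f \o *:%R r) x) @[h --> 0^'] -->
  r * 'D_v f (r *: x).
Proof.
move=> r0 df.
have r0' : r * h @[h --> (0 : R)^'] --> (0 : R)^'.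
  rewrite -[X in _ --> X^'](mulr0 r).
  apply: continuous_injective_withinNx => [|h]; first exact: mulrl_continuous.
  by move=> /(mulfI r0).
have dfr : r * (((r * h)^-1) *: ((f \o shift (r *: x)) ((r * h) *: v) - f (r *: x)))
    @[h --> (0 : R)^'] --> r * 'D_v f (r *: x).
  by apply: cvgMl_tmp; exact: (cvg_comp _ _ r0' df).
apply: cvg_trans dfr; apply: near_eq_cvg; near=> h => /=.
have h0 : h != 0 by near: h; exact: nbhs_dnbhs_neq.
rewrite [r *: (_ + _)]scalerDr scalerA -[LHS]/(r * (_^-1 * _)) mulrA invfM mulrA.
by rewrite divff// mul1r.
Unshelve. all: by end_near. Qed.

Lemma derivable_dilation (r : R) f x v : r != 0 ->
  derivable f (r *: x) v -> derivable (f \o *:%R r) x v.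
Proof.
by move=> r0 df; apply/cvg_ex; exists (r * 'D_v f (r *: x));
  exact: cvg_difference_quotient_dilation.
Qed.

Lemma derive_dilation (r : R) f x v : r != 0 ->
  derivable f (r *: x) v -> 'D_v (f \o *:%R r) x = r * 'D_v f (r *: x).
Proof.
by move=> r0 df; apply/cvg_lim => //; exact: cvg_difference_quotient_dilation.
Qed.

Lemma iterated_partial_dilation (r : R) (s : seq 'I_n) phi : r != 0 ->
  smooth phi ->
  iterated_partial s (phi \o *:%R r) =
  (fun x => r ^+ size s * (iterated_partial s phi \o *:%R r) x).
Proof.
move=> r0 sphi; elim: s => [|i s IHs] /=.
  by apply/funext => x; rewrite mul1r.
apply/funext => x; rewrite -/(iterated_partial s _) IHs.
have [_ ds] := sphi s.
have dsx := derivable_dilation r0 (ds i (r *: x)).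
by rewrite deriveZ//= derive_dilation// /GRing.scale/= mulrA exprSr.
Qed.

Lemma continuous_dilation (r : R) : continuous ( *:%R r : 'rV[R]_n -> 'rV[R]_n).
Proof. by move=> x; exact: (@cvgZl_tmp _ _ _ (nbhs x) _ r id x). Qed.

Lemma smooth_dilation (r : R) phi : r != 0 -> smooth phi -> smooth (phi \o *:%R r).
Proof.
move=> r0 sphi s; have [cs ds] := sphi s; rewrite iterated_partial_dilation//.
split=> [x|i x].
  apply: (@continuousM R _ (cst (r ^+ size s)) (iterated_partial s phi \o *:%R r));
    first exact: cst_continuous.
  by apply: continuous_comp; [exact: continuous_dilation|exact: cs].
by apply: derivableZ; apply: derivable_dilation.
Qed.

(** The support of the dilated function lies in the image of the compact support
    of [phi] under the inverse dilation. *)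
Lemma test_function_dilation (r : R) phi : r != 0 ->
  test_function phi -> test_function (phi \o *:%R r).
Proof.
move=> r0 [sphi cphi]; split; first exact: smooth_dilation.
pose K := ( *:%R r^-1) @` closure [set x | phi x != 0].
have cK : compact K.
  by apply: continuous_compact => //; apply: continuous_subspaceT; exact: continuous_dilation.
have clK : closed K by apply: compact_closed => //; exact: norm_hausdorff.
apply: (subclosed_compact _ cK); first exact: closed_closure.
rewrite closureE; apply: smallest_sub => // x /= phix.
by exists (r *: x); [exact: subset_closure|rewrite scalerK].
Qed.

End derive_dilation.

(** * Dilations in H^1 and the functionals *)

Section real_multiples.
Local Open Scope complex_scope.
Variable R : realType.
Implicit Types (b : R) (z : R[i]).

Lemma Re_realM b z : complex.Re (b%:C * z) = b * complex.Re z.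
Proof. by case: z => x y /=; rewrite mul0r subr0. Qed.

Lemma Im_realM b z : complex.Im (b%:C * z) = b * complex.Im z.
Proof. by case: z => x y /=; rewrite mul0r addr0. Qed.

Lemma normc_ge0 z : 0 <= Normc.normc z.
Proof. by case: z => x y; exact: sqrtr_ge0. Qed.

Lemma normc_realM b z : 0 <= b ->
  Normc.normc (b%:C * z) = b * Normc.normc z.
Proof.
case: z => x y b0 /=; rewrite !mul0r subr0 addr0 !exprMn -mulrDr.
by rewrite sqrtrM ?sqr_ge0// sqrtr_sqr ger0_norm.
Qed.

End real_multiples.

Section dilation_H1.
Local Open Scope complex_scope.
Variables (R : realType) (n : nat) (r : R).
Hypothesis r0 : 0 < r.
Implicit Types (a : R) (f g : 'rV[R]_n -> R[i]).

Definition dilated a f : 'rV[R]_n -> R[i] := fun x => a%:C * f (r *: x).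

Lemma square_integrable_dilated a f : 0 < a ->
  square_integrable f -> square_integrable (dilated a f).
Proof.
move=> a0 [[mRe mIm] f2]; split.
  split.
    under eq_fun do rewrite Re_realM.
    apply: (measurableT_comp (mulrl_measurable a)).
    exact: (measurableT_comp mRe (measurable_dilation r)).
  under eq_fun do rewrite Im_realM.
  apply: (measurableT_comp (mulrl_measurable a)).
  exact: (measurableT_comp mIm (measurable_dilation r)).
under eq_integral do rewrite normc_realM ?ltW// exprMn EFinM.
rewrite (integral_dilation (fun x => (Normc.normc (f x) ^+ 2)%:E)) ?exprn_gt0//.
by rewrite lte_mul_pinfty// lee_fin ltW// divr_gt0// exprn_gt0.
Qed.

Lemma cintegral_dilated a f : 0 < a ->
  cintegral (dilated a f) = (a * r ^- n)%:C * cintegral f.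
Proof.
move=> a0; rewrite /cintegral; apply/eqP; rewrite eq_complex; apply/andP; split; apply/eqP.
  rewrite Re_realM /= -Rintegral_dilation//.
  by apply: eq_Rintegral => x _; rewrite Re_realM.
rewrite Im_realM /= -Rintegral_dilation//.
by apply: eq_Rintegral => x _; rewrite Im_realM.
Qed.

(** Testing against [phi] is transported to testing against [phi (r^-1 x)]; the
    factor [r] on the gradient side comes from the chain rule. *)
Lemma weak_partial_dilated (i : 'I_n) a f g : 0 < a ->
  weak_partial i f g -> weak_partial i (dilated a f) (dilated (a * r) g).
Proof.
move=> a0 fg phi tphi.
pose psi := phi \o *:%R r^-1.
have rn0 : r != 0 by rewrite gt_eqF.
have tpsi : test_function psi by apply: test_function_dilation => //; rewrite invr_eq0.
have psiE x : psi (r *: x) = phi x by rewrite /psi/= scalerK.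
have dpsi x : 'D_(delta_mx 0 i) phi x = r * 'D_(delta_mx 0 i) psi (r *: x).
  have [/(_ [::])[_ dphi] _] := tphi.
  by rewrite /psi derive_dilation ?invr_eq0 ?scalerK// mulVKf.
rewrite [X in cintegral X](_ : _ =
    dilated (a * r) (fun x => f x * ('D_(delta_mx 0 i) psi x)%:C)); last first.
  by apply/funext => x; rewrite /dilated dpsi !rmorphM/=; ring.
rewrite [X in - cintegral X](_ : _ =
    dilated (a * r) (fun x => g x * (psi x)%:C)); last first.
  by apply/funext => x; rewrite /dilated psiE mulrA.
by rewrite !cintegral_dilated ?mulr_gt0// fg// mulrN.
Qed.

Definition dilated_H1 a (a0 : 0 < a) (u : H1 R n) : H1 R n := MkH1
  (square_integrable_dilated a0 (H1_square_integrable u))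
  (fun i => square_integrable_dilated (mulr_gt0 a0 r0)
              (H1_grad_square_integrable u i))
  (fun i => weak_partial_dilated a0 (@H1_weak_partial R n u i)).

End dilation_H1.

Section dilated_functionals.
Variables (R : realType) (D : nat) (r a p : R).
Hypotheses (r0 : 0 < r) (a0 : 0 < a).
Variable u : H1 R D.
Local Notation v := (dilated_H1 r0 a0 u).

Lemma mass_dilated : mass v = a ^+ 2 * r ^- D * mass u.
Proof.
rewrite /mass -Rintegral_dilation ?exprn_gt0//.
by apply: eq_Rintegral => x _; rewrite normc_realM ?ltW// exprMn.
Qed.

Lemma dirichlet_dilated : dirichlet v = (a * r) ^+ 2 * r ^- D * dirichlet u.
Proof.
rewrite /dirichlet -Rintegral_dilation ?exprn_gt0 ?mulr_gt0//.
apply: eq_Rintegral => x _; rewrite /grad_norm_sq mulr_sumr.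
by apply: eq_bigr => i _; rewrite normc_realM ?exprMn// ltW// mulr_gt0.
Qed.

Lemma power_term_dilated :
  power_term p v = a `^ (p + 1) * r ^- D * power_term p u.
Proof.
rewrite /power_term -Rintegral_dilation ?powR_gt0//.
apply: eq_Rintegral => x _; rewrite normc_realM ?ltW// powRM ?normc_ge0 ?(ltW a0)//.
Qed.

Lemma enormZ (x : 'rV[R]_D) : enorm (r *: x) ^+ 2 = r ^+ 2 * enorm x ^+ 2.
Proof.
have s0 (y : 'rV[R]_D) : 0 <= \sum_i y 0 i ^+ 2.
  by apply: sumr_ge0 => i _; exact: sqr_ge0.
rewrite !sqr_sqrtr// mulr_sumr; apply: eq_bigr => i _.
by rewrite mxE exprMn.
Qed.

Lemma hartree_potential_dilated x :
  hartree_potential v x =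
  ((a ^+ 2 * r ^+ 2 * r ^- D)%:E * hartree_potential u (r *: x))%E.
Proof.
rewrite /hartree_potential -integral_dilation ?mulr_gt0 ?exprn_gt0//.
apply: eq_integral => y _; rewrite -EFinM; congr EFin.
rewrite normc_realM ?ltW// exprMn -scalerBr enormZ (invfM (r ^+ 2)).
move: (enorm _ ^+ 2)^-1 (Normc.normc _ ^+ 2) => w z; field.
by rewrite gt_eqF.
Qed.

Lemma hartree_dilated :
  hartree v = a ^+ 4 * r ^+ 2 * (r ^- D) ^+ 2 * hartree u.
Proof.
rewrite /hartree.
rewrite (eq_integral (fun x : 'rV[R]_D => (a ^+ 4 * r ^+ 2 * r ^- D)%:E *
   (hartree_potential u (r *: x) * (Normc.normc (u (r *: x)) ^+ 2)%:E))%E); last first.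
  move=> x _; rewrite hartree_potential_dilated normc_realM ?ltW// exprMn.
  rewrite [(a ^+ 2 * _ ^+ 2)%:E]EFinM muleACA -EFinM.
  by congr (_%:E * _)%E; ring.
rewrite (integral_dilation
  (fun x => hartree_potential u x * (Normc.normc (u x) ^+ 2)%:E)%E)//; last first.
  by rewrite !mulr_gt0 ?exprn_gt0// invr_gt0 exprn_gt0.
rewrite fine_pmull ?[(r ^- D) ^+ 2]expr2 ?mulrA//.
by rewrite !mulr_gt0 ?exprn_gt0// invr_gt0 exprn_gt0.
Qed.

End dilated_functionals.

Section L2dilation.
Variables (R : realType) (D : nat) (p : R).

Let q : R := D%:R * (p - 1) / 2.

(** The amplitude [expR (D%:R / 2 * s)] is the one that keeps the mass constant. *)
Definition L2dilation (s : R) (u : H1 R D) : H1 R D :=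
  dilated_H1 (expR_gt0 s) (expR_gt0 (D%:R / 2 * s)) u.

Variables (u : H1 R D) (s : R).

Let amp2 : expR (D%:R / 2 * s) ^+ 2 = expR s ^+ D.
Proof. by rewrite -!expRM_natl; congr expR; field. Qed.

Lemma mass_L2dilation : mass (L2dilation s u) = mass u.
Proof.
by rewrite mass_dilated amp2 mulfV ?mul1r// expf_neq0// expR_eq0.
Qed.

Lemma dirichlet_L2dilation :
  dirichlet (L2dilation s u) = expR (2 * s) * dirichlet u.
Proof.
rewrite dirichlet_dilated exprMn amp2 expRM_natl; field.
by rewrite expf_neq0// expR_eq0.
Qed.

Lemma hartree_L2dilation : hartree (L2dilation s u) = expR (2 * s) * hartree u.
Proof.
rewrite hartree_dilated (exprM _ 2 2) amp2 expRM_natl; field.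
by rewrite expf_neq0// expR_eq0.
Qed.

Lemma power_term_L2dilation :
  power_term p (L2dilation s u) = expR (q * s) * power_term p u.
Proof.
rewrite power_term_dilated; congr (_ * _).
by rewrite -expRM -expRM_natl -expRN -expRD; congr expR; rewrite /q; field.
Qed.

End L2dilation.

(** * Null functions *)

Section null_functions.
Variables (R : realType) (D : nat).
Implicit Types u : H1 R D.

Lemma mass_eq0_H1_eq0 u : mass u = 0 -> H1_eq0 u.
Proof.
move=> mu0; have [[mRe mIm] u2] := H1_square_integrable u.
pose w x := (Normc.normc (u x) ^+ 2)%:E.
have w0 x : (0 <= w x)%E by rewrite lee_fin sqr_ge0.
have mw : measurable_fun setT w.
  apply/measurable_EFinP; rewrite (_ : (fun x => _) =
      (fun x => complex.Re (u x) ^+ 2 + complex.Im (u x) ^+ 2)); last first.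
    apply/funext => x; case: (H1_fun u x) => b c /=.
    by rewrite sqr_sqrtr// addr_ge0 ?sqr_ge0.
  by apply: measurable_funD; exact: measurable_funX.
have w_int0 : (\int[lebesgue_rV R D]_x w x = 0)%E.
  have : (\int[lebesgue_rV R D]_x w x)%E \is a fin_num.
    by rewrite ge0_fin_numE// integral_ge0.
  by move=> /fineK <-; rewrite -[fine _]/(mass u) mu0.
have : ae_eq (lebesgue_rV R D) setT w (cst 0%E).
  apply/(ae_eq_integral_abs _ measurableT mw).
  by under eq_integral do rewrite gee0_abs//.
apply: filterS => x /(_ I) /= /eqP; rewrite eqe expf_eq0/=.
by move=> /eqP /Normc.eq0_normc.
Qed.

Lemma H1_eq0_mass u : H1_eq0 u -> mass u = 0.
Proof.
move=> u0; rewrite /mass /Rintegral ge0_integral_ae_eq0//.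
  by move=> x; rewrite lee_fin sqr_ge0.
by apply: filterS u0 => x ->; rewrite Normc.normc0 expr0n.
Qed.

Lemma H1_eq0_power_term (p : R) u : p + 1 != 0 -> H1_eq0 u -> power_term p u = 0.
Proof.
move=> p0 u0; rewrite /power_term /Rintegral ge0_integral_ae_eq0//.
  by move=> x; rewrite lee_fin powR_ge0.
by apply: filterS u0 => x ->; rewrite Normc.normc0 powR0.
Qed.

Lemma H1_eq0_hartree u : H1_eq0 u -> hartree u = 0.
Proof.
move=> u0; rewrite /hartree integral0_eq// => x _.
rewrite [hartree_potential u x]ge0_integral_ae_eq0 ?mul0e//.
  by move=> y; rewrite lee_fin divr_ge0 ?sqr_ge0.
by apply: filterS u0 => y ->; rewrite Normc.normc0 expr0n mul0r.
Qed.

(** If the mass vanished, [u] would be null, and the functional [Nfun] would reduce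
    to the Dirichlet integral. *)
Lemma mass_gt0 (omega p : R) u : p + 1 != 0 ->
  Nfun omega p u < 0 -> 0 < mass u.
Proof.
move=> p0 N0; rewrite lt_def Rintegral_ge0 ?andbT => [|x _]; last exact: sqr_ge0.
apply: contraTneq N0 => m0; have u0 := mass_eq0_H1_eq0 m0.
rewrite -leNgt /Nfun /Kfun m0 H1_eq0_power_term// H1_eq0_hartree//.
rewrite mulr0 addr0 !subr0 Rintegral_ge0// => x _.
by apply: sumr_ge0 => i _; exact: sqr_ge0.
Qed.

End null_functions.

(** * Two facts about real exponentials *)

Section real_lemmas.
Variable R : realType.
Implicit Types A H m P q s : R.

(** Intermediate value theorem between 0 and the point where [expR (2 * s)] equals
    [e := m / (H + P - A)]: there [expR (q * s) <= e], so that the function is at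
    least [m - e * (H - A + P)], which is 0. *)
Lemma exists_dilation_zero A H m P q : 0 < m -> 0 <= P -> 2 <= q ->
  A + m - P - H < 0 ->
  exists2 s, s <= 0 & expR (2 * s) * A + m - expR (q * s) * P - expR (2 * s) * H = 0.
Proof.
move=> m0 P0 q2 N0.
pose F s := expR (2 * s) * A + m - expR (q * s) * P - expR (2 * s) * H.
have d0 : 0 < H + P - A by lra.
pose e := m / (H + P - A).
have e0 : 0 < e by rewrite divr_gt0.
have e1 : e <= 1 by rewrite ler_pdivrMr//; lra.
pose s0 := ln e / 2.
have s00 : s0 <= 0 by rewrite /s0 pmulr_lle0 ?invr_gt0// ln_le0.
have es0 : expR (2 * s0) = e by rewrite /s0 mulrC divfK// lnK.
have Fs0 : 0 <= F s0.
  have : expR (q * s0) <= e by rewrite -es0 ler_expR; nra.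
  have eE : e * (H + P - A) = m by rewrite divfK// gt_eqF.
  by rewrite /F es0; nra.
have F0 : F 0 <= 0 by rewrite /F !mulr0 expR0; lra.
have cF : continuous F.
  have cE k : continuous (fun s : R => expR (k * s)).
    move=> s; apply: continuous_comp; first exact: mulrl_continuous.
    exact: continuous_expR.
  by move=> s; apply: cvgB; [apply: cvgB; [apply: cvgD; [|exact: cvg_cst]|]|];
    apply: cvgM; (exact: cE || exact: cvg_cst).
have [||s] := @IVT R F s0 0 0 s00.
- exact: continuous_subspaceT.
- by rewrite ge_min F0 orbT/= le_max Fs0.
by rewrite in_itv/= => /andP[_ s1] Fs; exists s.
Qed.

(** Bernoulli's inequality for the exponent [q / 2 >= 1] and the positive number
    [expR (2 * s)]; it follows from the tangent bound [1 + x <= expR x] at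
    [x := (q - 2) * s] and at [x := - (2 * s)]. *)
Lemma ler_expR_powers q s : 2 <= q ->
  q / 2 * (expR (2 * s) - 1) <= expR (q * s) - 1.
Proof.
move=> q2; set y := expR (2 * s).
have y0 : 0 < y by exact: expR_gt0.
have h1 : 1 - 2 * s <= y^-1 by rewrite -expRN; exact: expR_ge1Dx.
have h2 : y * (1 - 2 * s) <= 1 by rewrite -ler_pdivlMl// mulr1.
have h3 : y * (1 + (q - 2) * s) <= expR (q * s).
  rewrite (_ : q * s = 2 * s + (q - 2) * s); last by ring.
  by rewrite expRD ler_pM2l// expR_ge1Dx.
nra.
Qed.

End real_lemmas.

(** * Comparison of the two infima *)

Theorem proposition1p3 (R : realType) (D : nat) (omega p : R)
  (hD : (3 <= D)%N) (homega : 0 < omega)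
  (hp1 : 1 + 4 / D%:R <= p) (hp2 : p < 1 + 4 / (D%:R - 2)) :
  (dN D omega p <= dM D omega p)%E.
Proof.
have D0 : 0 < D%:R :> R by rewrite ltr0n (leq_trans _ hD).
have D4 : 0 < 4 / D%:R :> R by rewrite divr_gt0.
have p1 : 0 < p + 1 by lra.
pose q := D%:R * (p - 1) / 2.
have q2 : 2 <= q.
  have : 4 / D%:R <= p - 1 by lra.
  by rewrite ler_pdivrMr// /q; lra.
apply: le_ereal_inf_tmp => _ [u [Nu Vu] <-].
have m0 := mass_gt0 (lt0r_neq0 p1) Nu.
have P0 : 0 <= power_term p u by apply: Rintegral_ge0 => x _; exact: powR_ge0.
have [s s0 Ns] := exists_dilation_zero (mulr_gt0 homega m0) P0 q2 Nu.
apply: (@le_trans _ _ (Defs.Lfun omega p (L2dilation s u))%:E).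
  apply: ereal_inf_lbound; exists (L2dilation s u) => //; split.
    by move=> /H1_eq0_mass; rewrite mass_L2dilation; apply/eqP; rewrite gt_eqF.
  rewrite /Nfun /Kfun mass_L2dilation dirichlet_L2dilation hartree_L2dilation.
  by rewrite power_term_L2dilation.
rewrite lee_fin /Defs.Lfun /Kfun mass_L2dilation dirichlet_L2dilation.
rewrite hartree_L2dilation power_term_L2dilation -/q.
have := ler_expR_powers s q2.
move: Vu; rewrite /Vfun.
have -> : D%:R * (p - 1) / (2 * (p + 1)) = q * (p + 1)^-1.
  by rewrite /q invfM mulrA.
set A := dirichlet u; set H := hartree u; set P := power_term p u.
set x := expR (2 * s); set y := expR (q * s) => Vu xy.
have k0 : 0 <= (p + 1)^-1 * P by rewrite mulr_ge0// invr_ge0 ltW.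
have := ler_wpM2l k0 xy; rewrite -subr_ge0 => h.
(* Once [Vu] eliminates the Dirichlet integral, [L u - L (L2dilation s u)] is
   Bernoulli's inequality multiplied by [P / (p + 1)]. *)
rewrite -subr_ge0; rewrite [leRHS](_ : _ = (p + 1)^-1 * P * (y - 1) -
   (p + 1)^-1 * P * (q / 2 * (x - 1)))//.
rewrite (_ : A = q * (p + 1)^-1 * P + 2^-1 * H); last by lra.
by field; rewrite gt_eqF.
Qed.
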